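(* Let $\mathcal{E}$ be a Euclidean vector space and $C$ a nonempty closed subset of $\mathcal{E}$. For every continuously differentiable function $\varphi:\mathcal{E}\to\mathbb{R}$, the function $C\to\mathbb{R}:x\mapsto d(-\nabla\varphi(x),N_C(x))$ is lower semicontinuous.
   Context: $\mathcal{E}$ is a finite-dimensional real inner product space. For a nonempty set $S$, $d(x,S)=\inf_{y\in S}\|x-y\|$. For $x\in C$: the tangent cone $T_C(x)$ is the set of all $v$ for which there exist sequences $(x_i)$ in $C$ converging to $x$ and $(t_i)$ in $(0,\infty)$ with $(x_i-x)/t_i\to v$; the regular normal cone is $\widehat N_C(x)=\{w\mid\langle v,w\rangle\le 0\ \forall v\in T_C(x)\}$; the normal cone $N_C(x)$ is the set of all $w$ for which there exist sequences $(x_i)$ in $C$ converging to $x$ and $(w_i)$ converging to $w$ with $w_i\in\widehat N_C(x_i)$ for all $i$. *)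

(* Defs.v *)
From HB Require Import structures.
From mathcomp Require Import all_boot all_order all_algebra.
From mathcomp Require Import all_classical all_reals.
From mathcomp Require Import topology normedtype sequences derive.

Set Implicit Arguments.
Unset Strict Implicit.
Unset Printing Implicit Defensive.

Import Order.TTheory GRing.Theory Num.Theory.
Import numFieldNormedType.Exports.

Local Open Scope classical_set_scope.
Local Open Scope ring_scope.

(* The topology is the one of the norm (NormedModule), the dimension is finite
   (Vector), and the norm is the one induced by the inner product. *)
HB.mixin Record NormedVector_isEuclidean (R : realType) E
    of NormedModule R E & Vector R E := {
  inner : {dot E for (@idfun R)};
  norm_inner : forall x : E, `|x| = Num.sqrt (inner x x)
}.

#[short(type="euclideanType")]
HB.structure Definition Euclidean (R : realType) :=
  {E of NormedModule R E & Vector R E & NormedVector_isEuclidean R E}.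

Section variational_analysis.
Context {R : realType} {E : euclideanType R}.
Implicit Types (C S : set E) (f : E -> R) (x v w : E).

Definition dist x S : R := inf [set `|x - y| | y in S].

(* The Riesz representative of the differential; see [gradE]. *)
Definition grad f x : E :=
  xget 0 [set g | forall v, 'd f x v = inner g v].

Definition C1 f := (forall x, differentiable f x) /\ continuous (grad f).

Definition tangent_cone C x : set E :=
  [set v | exists (x_ : nat -> E) (t_ : nat -> R),
    [/\ forall i, C (x_ i), x_ i @[i --> \oo] --> x, forall i, 0 < t_ i
      & (t_ i)^-1 *: (x_ i - x) @[i --> \oo] --> v]].

Definition regular_normal_cone C x : set E :=
  [set w | forall v, tangent_cone C x v -> inner v w <= 0].

Definition normal_cone C x : set E :=
  [set w | exists (x_ w_ : nat -> E),
    [/\ forall i, C (x_ i), x_ i @[i --> \oo] --> x, w_ i @[i --> \oo] --> w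
      & forall i, regular_normal_cone C (x_ i) (w_ i)]].

Lemma inner_gt0 x : x != 0 -> 0 < inner x x.
Proof. exact: neq0_dnorm_gt0. Qed.

Lemma innerC x y : inner x y = inner y x.
Proof. by rewrite hermitian_subproof expr0 mul1r. Qed.

Lemma riesz (l : {linear E -> R^o}) : exists g : E, forall v, l v = inner g v.
Proof.
pose h (g : E) : 'Hom(E, R^o) := linfun (inner g : {linear E -> R^o}).
have hE g v : h g v = inner g v by rewrite lfunE.
have h_lin : linear h.
  move=> a u v; apply/lfunP => w.
  by rewrite add_lfunE scale_lfunE !hE !(innerC _ w) linearD linearZ.
pose hL : {linear E -> 'Hom(E, R^o)} :=
  HB.pack h (GRing.isLinear.Build _ _ _ _ h h_lin).
have ker0 : lker (linfun hL) == 0%VS.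
  apply/lker0P => u v; rewrite !lfunE /= => huv.
  apply/eqP; rewrite -subr_eq0; apply/negP => /negP /inner_gt0.
  by rewrite linearB /= (innerC _ u) (innerC _ v) -!hE huv subrr ltxx.
have full : (linfun hL @: fullv)%VS = fullv.
  apply/eqP; rewrite eqEdim subvf /=.
  by rewrite limg_dim_eq ?(eqP ker0) ?capv0 // !dimvf /= /dim /= muln1.
have : linfun l \in (linfun hL @: fullv)%VS by rewrite full memvf.
case/memv_imgP => g _ lg; exists g => v.
by rewrite -hE -[RHS]/(hL g v) -[hL g](lfunE hL) -lg lfunE.
Qed.

Lemma gradE f x v : 'd f x v = inner (grad f x) v.
Proof.
have [g gE] := riesz ('d f x).
by rewrite /grad; case: xgetP => [y _ ->//|/(_ g)].
Qed.

End variational_analysis.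

(* Main.v *)
Require Import Defs.
From mathcomp Require Import all_boot all_order all_algebra.
From mathcomp Require Import all_classical all_reals.
From mathcomp Require Import topology normedtype sequences derive.
From mathcomp Require Import interval_inference lra.

Set Implicit Arguments.
Unset Strict Implicit.
Unset Printing Implicit Defensive.

Import Order.TTheory GRing.Theory Num.Theory.
Import numFieldNormedType.Exports.
Local Open Scope classical_set_scope.
Local Open Scope ring_scope.

(* The graph of the normal cone map is closed by a diagonal argument. If the
   points y_n of C tend to x with d(-grad phi (y_n), N_C(y_n)) <= a, there are
   u_n in N_C(y_n) with |-grad phi (y_n) - u_n| <= a + 1/n; by continuity of the
   gradient they are bounded, hence cluster at some w in N_C(x), and
   |-grad phi (x) - w| <= a. *)

Section euclidean.
Context {R : realType} {E : euclideanType R}.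
Implicit Types (C S : set E) (x v w : E).

Lemma inner_normE v : inner v v = `|v| ^+ 2.
Proof.
rewrite norm_inner sqr_sqrtr //.
by have [->|/inner_gt0/ltW //] := eqVneq v 0; rewrite linear0r.
Qed.

(** Cauchy-Schwarz comes from the triangle inequality of the norm: after squaring and expanding,
    only the cross terms remain. *)
Lemma inner_le_norm v w : inner v w <= `|v| * `|w|.
Proof.
have : `|v + w| ^+ 2 <= (`|v| + `|w|) ^+ 2.
  by rewrite lerXn2r ?nnegrE ?addr_ge0 // ler_normD.
rewrite -inner_normE linearDr /= !(innerC (v + w)) !linearDr /= !inner_normE.
by rewrite (innerC w v) sqrrD; lra.
Qed.

Lemma normr_inner_le v w : `|inner v w| <= `|v| * `|w|.
Proof.
rewrite ler_norml inner_le_norm andbT lerNl -linearN /=.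
by rewrite (le_trans (inner_le_norm _ _)) // normrN.
Qed.

(* Coordinates are inner products with fixed vectors, so by Cauchy-Schwarz a
   ball is contained in the image of a compact box under a linear
   parametrization of the space. *)
Lemma bounded_sub_compact (M : R) :
  exists2 K : set E, compact K & forall v, `|v| <= M -> K v.
Proof.
pose n := \dim (fullv : {vspace E}).
pose b : n.-tuple E := vbasis fullv.
have /choice[g gE] : forall i : 'I_n, exists g : E,
    forall v, coord b i v = inner g v.
  by move=> i; exact: (riesz (coord b i)).
pose f (r : 'rV[R]_n) : E := \sum_(i < n) r ord0 i *: b`_i.
have f_cont : continuous f.
  apply: (continuous_big add_continuous) => i _ r.
  exact: (cvgZr_tmp (@coord_continuous R 1 n ord0 i r)).
pose box := [set r : 'rV[R]_n |
  forall i, (`[- (`|g i| * M), `|g i| * M]%classic : set R) (r ord0 i)].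
exists (f @` box).
  apply: continuous_compact; first exact: continuous_subspaceT.
  apply: (@rV_compact R n (fun i => `[- (`|g i| * M), `|g i| * M]%classic)) => i.
  exact: segment_compact.
move=> v vM; exists (\row_i coord b i v).
  move=> i /=; rewrite mxE gE in_itv /= -ler_norml.
  by apply: le_trans (normr_inner_le _ _) _; rewrite ler_wpM2l.
rewrite [RHS](coord_vbasis (memvf v)).
by apply: eq_bigr => i _; rewrite mxE.
Qed.

Lemma dist_le x S v : S v -> dist x S <= `|x - v|.
Proof.
move=> Sv; apply: ge_inf; last by exists v.
by exists 0 => _ [y _ <-].
Qed.

Lemma dist_lt x S (r : R) : S !=set0 -> dist x S < r ->
  exists2 v, S v & `|x - v| < r.
Proof.
move=> S0 /inf_lt[|_ [w Sw <-] ltr]; last by exists w.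
exact: image_nonempty.
Qed.

Lemma regular_normal_cone0 C x : regular_normal_cone C x 0.
Proof. by move=> v _; rewrite linear0r. Qed.

Lemma normal_cone0 C x : C x -> normal_cone C x 0.
Proof.
move=> Cx; exists (fun=> x), (fun=> 0); split => //; try exact: cvg_cst.
by move=> i; exact: regular_normal_cone0.
Qed.

(** Trades sequences for a single tolerance, so that diagonal arguments reduce to adding errors.
    Conversely, choosing a pair for each tolerance [1/(n+1)] rebuilds the two sequences. *)
Lemma normal_coneP C x w : normal_cone C x w <->
  forall e : R, 0 < e -> exists y u,
    [/\ C y, `|x - y| < e, `|w - u| < e & regular_normal_cone C y u].
Proof.
split=> [[x_ [w_ [Cx_ xx_ ww_ Nw_]]] e e0|H].
  have [i [? ?]] : exists i, `|x - x_ i| < e /\ `|w - w_ i| < e.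
    near \oo => i; exists i; split; near: i.
      by move/cvgrPdist_lt: xx_; exact.
    by move/cvgrPdist_lt: ww_; exact.
  by exists (x_ i), (w_ i).
have /choice[p pP] : forall n : nat, exists p : E * E,
    [/\ C p.1, `|x - p.1| < n.+1%:R^-1, `|w - p.2| < n.+1%:R^-1
      & regular_normal_cone C p.1 p.2].
  move=> n; have [|y [u ?]] := H n.+1%:R^-1; first by rewrite invr_gt0.
  by exists (y, u).
exists (fst \o p), (snd \o p); split => [i|||i]; try by case: (pP i).
- apply/cvgrPdist_lt => e e0; near=> n.
  have [_ lt _ _] := pP n; apply: lt_trans lt _.
  near: n; exact: near_infty_natSinv_lt (PosNum e0).
- apply/cvgrPdist_lt => e e0; near=> n.
  have [_ _ lt _] := pP n; apply: lt_trans lt _.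
  near: n; exact: near_infty_natSinv_lt (PosNum e0).
Unshelve. all: by end_near. Qed.

(** Lower semicontinuity in contrapositive form, for any map [g] continuous at [x] in place of the
    negative gradient. *)
Lemma dist_normal_cone_le C (g : E -> E) x (a : R) :
  {for x, continuous g} ->
  (forall e : R, 0 < e -> exists y,
    [/\ C y, `|x - y| < e & dist (g y) (normal_cone C y) <= a]) ->
  dist (g x) (normal_cone C x) <= a.
Proof.
move=> g_cont near_x.
(* Diagonal step: a nearly optimal normal [w] at [y] is replaced by a regular normal [u] at a nearby
   [z]. The errors add up to [e/2 + e/4] for the points and to [a + 3e/4] for the vectors. *)
have approx (e : R) : 0 < e -> exists y u,
    [/\ C y, `|x - y| < e, `|g x - u| < a + e & regular_normal_cone C y u].
  move=> e0; have e20 : 0 < e / 2 by rewrite divr_gt0.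
  have e40 : 0 < e / 4 by rewrite divr_gt0.
  have : \forall y \near x, `|g x - g y| < e / 4.
    by move/cvgrPdist_lt: g_cont; exact.
  move=> /nbhs_ballP[r /= r0 rP].
  have [|y [Cy xy disty]] := near_x (Num.min r (e / 2)).
    by rewrite lt_min r0.
  move: xy; rewrite lt_min => /andP[xyr xye].
  have gxy : `|g x - g y| < e / 4 by apply: rP; rewrite -ball_normE.
  (* The cone at [y] contains 0, so the infimum is over a nonempty set and is approached within
     [e / 4]. *)
  have [||w Nw gyw] := @dist_lt (g y) (normal_cone C y) (a + e / 4).
  - by exists 0; exact: normal_cone0.
  - by rewrite (le_lt_trans disty) // ltrDl.
  have [z [u [Cz yz wu Nu]]] := (normal_coneP _ _ _).1 Nw _ e40.
  exists z, u; split => //.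
    have := ler_distD y x z; lra.
  have := ler_distD (g y) (g x) u; have := ler_distD w (g y) u; lra.
have /choice[p pP] : forall n : nat, exists p : E * E,
    [/\ C p.1, `|x - p.1| < n.+1%:R^-1, `|g x - p.2| < a + n.+1%:R^-1
      & regular_normal_cone C p.1 p.2].
  move=> n; have [|y [u ?]] := approx n.+1%:R^-1; first by rewrite invr_gt0.
  by exists (y, u).
(* The radius bounds every chosen normal, since [1/(n+1)] is at most 1. *)
have [K Kcompact Kball] := bounded_sub_compact (`|g x| + (a + 1)).
have K_p : \forall n \near \oo, K (p n).2.
  apply: nearW => n; apply: Kball; have [_ _ pn _] := pP n.
  have : n.+1%:R^-1 <= 1 :> R by rewrite invf_le1 ?ltr0n // ler1n.
  have := ler_normB (g x) (g x - (p n).2); rewrite subKr.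
  by move: pn; set t := _^-1; lra.
have [w [_ w_cluster]] := Kcompact (snd \o p @ \oo) _ K_p.
have near_w (e : R) : 0 < e -> exists n, `|w - (p n).2| < e /\ n.+1%:R^-1 < e.
  move=> e0.
  (* A cluster point meets every tail of the sequence, which makes [1/(n+1)] small at the same
     index; no subsequence is extracted. *)
  have tail : (snd \o p @ \oo) ((snd \o p) @` [set n | n.+1%:R^-1 < e]).
    by apply: filterS (near_infty_natSinv_lt (PosNum e0)) => n ne; exists n.
  have [_ [[n ne <-] wn]] := w_cluster _ _ tail (nbhsx_ballx w e e0).
  by exists n; split => //; move: wn; rewrite -ball_normE.
have Nw : normal_cone C x w.
  apply/normal_coneP => e /near_w[n [wn ne]].
  have [Cn xn _ Nn] := pP n; exists (p n).1, (p n).2; split => //.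
  exact: lt_trans ne.
apply: le_trans (dist_le _ Nw) _; apply/ler_addgt0Pr => e e0.
have [|n [wn ne]] := near_w (e / 2); first by rewrite divr_gt0.
have [_ _ gn _] := pP n.
have := ler_distD (p n).2 (g x) w; rewrite (distrC (p n).2).
by move: ne gn; set t := n.+1%:R^-1; lra.
Unshelve. all: by end_near. Qed.

End euclidean.

Theorem proposition2p12 (R : realType) (E : euclideanType R) (C : set E)
    (C_nonempty : C !=set0) (C_closed : closed C) (phi : E -> R)
    (phi_C1 : C1 phi) :
  lower_semicontinuous
    (fun x : C => (dist (- grad phi (val x)) (normal_cone C (val x)))%:E).
Proof.
move=> x a; rewrite lte_fin => a_lt.
have [e e0 eP] : exists2 e : R, 0 < e & forall y, C y -> `|val x - y| < e ->
    a < dist (- grad phi y) (normal_cone C y).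
  (* Without such a radius, points of [C] with distance at most [a] accumulate at [x], which forces
     the distance at [x] down to [a]. *)
  apply: contrapT => far; move: a_lt; rewrite ltNge => /negP; apply.
  apply: (@dist_normal_cone_le _ _ C (fun y => - grad phi y)).
    by apply: cvgN; exact: phi_C1.2.
  move=> e e0; apply: contrapT => none; apply: far; exists e => // y Cy xy.
  by rewrite ltNge; apply/negP => ?; apply: none; exists y.
(* Neighbourhoods in [C] are taken in the initial topology of [val], hence the preimage of a
   ball. *)
exists (val @^-1` ball (val x) e).
  have /(_ x) := @initial_continuous C E val; apply.
  exact: nbhsx_ballx.
move=> y /=; rewrite -ball_normE /= => xy; rewrite lte_fin.
by apply: eP => //; exact: set_mem (valP y).
Qed.
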